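(* No finite primitive permutation group of type TW (twisted wreath) contains a quasi-semiregular element.
   Context: A permutation $g$ is quasi-semiregular if $\langle g\rangle$ has a unique fixed point and acts semiregularly (only the identity fixes a point) on the remaining points. TW is the O'Nan–Scott type of primitive groups $G=T^k\rtimes H$ with regular nonabelian socle $T^k$ ($T$ simple, $k\ge 2$), where the stabiliser $H$ permutes the $k$ factors transitively and a subgroup $L=N_H(T_1)$ of index $k$ acts on $T$ via a homomorphism $L\to\mathrm{Aut}(T)$. *)

(* Defs.v *)
From mathcomp Require Import all_boot all_fingroup all_solvable.
Set Implicit Arguments. Unset Strict Implicit. Unset Printing Implicit Defensive.
Local Open Scope group_scope.

Section Defs.
Variable gT : finGroupType.

Definition socle (G : {set gT}) : {set gT} :=
  <<\bigcup_(N : {group gT} | minnormal N G && (N \subset G)) N>>.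

Definition is_power (N T : {set gT}) (k : nat) : Prop :=
  exists Ti : 'I_k -> {group gT},
    \big[dprod/1]_(i < k) Ti i = N /\ forall i, Ti i \isog T.
End Defs.

Section PermDefs.
Variable Omega : finType.

Definition semiregular_on (A : {set {perm Omega}}) (S : {set Omega}) : Prop :=
  forall x, x \in S -> 'C_A[x | 'P] = 1.

Definition regular_on (A : {set {perm Omega}}) (S : {set Omega}) : Prop :=
  [transitive A, on S | 'P] /\ semiregular_on A S.

Definition quasi_semiregular (g : {perm Omega}) : Prop :=
  exists2 a : Omega, 'Fix_('P)(<[g]>) = [set a] &
                     semiregular_on <[g]> [set~ a].

Definition TW_type (G : {group {perm Omega}}) : Prop :=
  [/\ regular_on (socle G) [set: Omega], ~~ abelian (socle G) &
      exists (T : {group {perm Omega}}) (k : nat),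
        [/\ 2 <= k, simple T, ~~ abelian T & is_power (socle G) T k]].
End PermDefs.

(* Main.v *)
Require Import Defs.
From HB Require Import structures.
From mathcomp Require Import all_boot all_fingroup all_solvable.
From mathcomp Require Import ssralg.

(* Since the socle N is regular, a power of prime order of a quasi-semiregular element acts on N
   by conjugation without nontrivial fixed points. Groups with such an automorphism are
   nilpotent (Thompson), whereas N has nonabelian simple factors.

   The nilpotence follows by induction from Thompson's p-complement theorem: if p is odd and
   the normalizers of J(R) and Z(R) are p-nilpotent, R a Sylow p-subgroup of G, then G is
   p-nilpotent. In a minimal counterexample, U = O_p(G) contains its centralizer and G / U is
   the product of R / U and a normal abelian p'-group H / U; some abelian subgroup of R of
   maximal order lies outside U, hence provides an x outside U acting quadratically on Z(U), and
   for p odd such an x centralizes H / U, which is absurd. *)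

Set Implicit Arguments. Unset Strict Implicit. Unset Printing Implicit Defensive.
Local Open Scope group_scope.

(** * p-nilpotent groups *)

(** A normal p-complement, if there is one, is the p'-core, so no quantifier over complements is
    needed. *)
Definition p_nilpotent (p : nat) (gT : finGroupType) (G : {set gT}) :=
  p^'.-Hall(G) 'O_p^'(G).

Lemma p_elts_pgroup (p : nat) (gT : finGroupType) (G : {group gT}) :
  (forall x, x \in G -> p^'.-elt x -> x = 1) -> p.-group G.
Proof.
move=> p'1; apply/pgroupP=> q q_pr q_dv; have [x Gx ox] := Cauchy q_pr q_dv.
apply: contraT => q'p; have: x = 1 by apply: p'1; rewrite // /p_elt ox pnatE.
by move=> x1; move: q_pr; rewrite -ox x1 order1.
Qed.

Section PNilpotent.
Variables (p : nat) (gT : finGroupType).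
Implicit Types G H K U Q : {group gT}.

Lemma p_nilpotentS G H : H \subset G -> p_nilpotent p G -> p_nilpotent p H.
Proof.
move=> sHG pnG; rewrite /p_nilpotent.
have hallI := setI_normal_Hall (pcore_normal p^' G) pnG sHG.
have nsI: 'O_p^'(G) :&: H <| H by rewrite setIC (normalGI sHG) ?pcore_normal.
by rewrite (normal_Hall_pcore hallI).
Qed.

(** [U] and the p'-core normalize each other and have coprime orders, so their commutator lies in
    their trivial intersection. *)
Lemma p_nilpotent_cent G U Q :
    p_nilpotent p G -> p.-group U -> U <| G -> Q \subset G -> p^'.-group Q ->
  Q \subset 'C(U).
Proof.
move=> pnG pU nsUG sQG p'Q.
have sQO: Q \subset 'O_p^'(G) by rewrite (sub_Hall_pcore pnG).
apply: subset_trans sQO _; rewrite centsC.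
apply/commG1P/trivgP.
have coUO: coprime #|U| #|'O_p^'(G)|.
  exact: (pnat_coprime pU (pcore_pgroup _ _)).
rewrite -(coprime_TIg coUO) commg_subI //.
  by rewrite subsetI subxx (subset_trans (normal_sub nsUG)) ?gFnorm.
by rewrite subsetI subxx (subset_trans (pcore_sub _ _)) ?normal_norm.
Qed.

Lemma p_nilpotent_p'quo G K :
  K <| G -> p^'.-group K -> p_nilpotent p (G / K) -> p_nilpotent p G.
Proof.
move=> nsKG p'K; rewrite /p_nilpotent pquotient_pcore // => /and3P[_ _ ind].
rewrite /pHall pcore_sub pcore_pgroup /=.
move: ind; rewrite index_quotient_eq ?pcore_sub ?normal_norm //.
by rewrite (subset_trans (subsetIr _ _)) // pcore_max.
Qed.

Lemma p_nilpotent_pext G K :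
  K <| G -> p_nilpotent p K -> p.-group (G / K) -> p_nilpotent p G.
Proof.
move=> nsKG pnK pGK; have [sKG nKG] := andP nsKG.
have nsOG: 'O_p^'(K) <| G by apply: gFnormal_trans.
suff hallO: p^'.-Hall(G) 'O_p^'(K).
  by rewrite /p_nilpotent (normal_Hall_pcore hallO).
rewrite /pHall (normal_sub nsOG) pcore_pgroup /= -(Lagrange_index sKG (pcore_sub _ _)).
rewrite pnatM -card_quotient //; case/and3P: pnK => _ _ ->.
by rewrite pnatNK andbT.
Qed.

Lemma p_nilpotent_quo G K : G \subset 'N(K) -> p_nilpotent p G -> p_nilpotent p (G / K).
Proof.
move=> nKG pnG; have hallO: p^'.-Hall(G / K) ('O_p^'(G) / K).
  by apply: quotient_pHall => //; apply: subset_trans (pcore_sub _ _) nKG.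
by rewrite /p_nilpotent (normal_Hall_pcore hallO) // quotient_normal ?pcore_normal.
Qed.

Lemma p_nilpotentJ G x : p_nilpotent p (G :^ x) = p_nilpotent p G.
Proof. by rewrite /p_nilpotent pcoreJ pHallJ2. Qed.

Lemma pgroup_p_nilpotent G : p.-group G -> p_nilpotent p G.
Proof.
move=> pG; suff hall1: p^'.-Hall(G) (1%G : {set gT}).
  by rewrite /p_nilpotent (normal_Hall_pcore hall1) ?normal1.
by rewrite /pHall sub1G pgroup1 indexg1 /= pnatNK.
Qed.

Lemma p'group_p_nilpotent G : p^'.-group G -> p_nilpotent p G.
Proof. by move=> p'G; rewrite /p_nilpotent pcore_pgroup_id // /pHall subxx p'G indexgg. Qed.

(** The p'-part of any lift of a p'-element of [N / C] is again a lift, and it lies in [C]. *)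
Lemma p'elts_quo_pgroup (N C : {group gT}) :
    N \subset 'N(C) -> (forall x, x \in N -> p^'.-elt x -> x \in C) ->
  p.-group (N / C).
Proof.
move=> nCN p'C; apply: p_elts_pgroup => _ /morphimP[x nCx Nx ->] p'x.
rewrite -(constt_p_elt p'x) -morph_constt //=.
by rewrite coset_id // p'C ?groupX // p_elt_constt.
Qed.
End PNilpotent.

(** * Frobenius' normal p-complement theorem *)

Import FiniteModule.
Section Fusion.
Variables (p : nat) (gT : finGroupType).
Implicit Types G H K U P S : {group gT}.

(* The p'-elements normalizing a p-subgroup centralize it: this inherits to subgroups, unlike
   the p-nilpotence of all normalizers of nontrivial p-subgroups. *)
Definition p_central G := forall U x,
  p.-group U -> U \subset G -> x \in 'N_G(U) -> p^'.-elt x -> x \in 'C(U).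

(** ['N_G(U) / 'C_G(U)] is a p-group, so the index of the product in ['N_G(U)] is both a power of p
    and prime to p. *)
Lemma p_central_Sylow_mul G U S :
  p_central G -> p.-group U -> U \subset G -> p.-Sylow('N_G(U)) S -> S * 'C_G(U) = 'N_G(U).
Proof.
move=> cG pU sUG sylS; have [sSN pS pind] := and3P sylS.
have nsCN: 'C_G(U) <| 'N_G(U).
  by rewrite /normal setIS ?cent_sub // normsI ?subsetIl ?normG ?norms_cent ?subsetIr //
    subIset ?normG.
have nCS := subset_trans sSN (normal_norm nsCN).
rewrite -norm_joinEl //; apply/eqP; rewrite eqEsubset join_subG sSN (normal_sub nsCN) /=.
have pNC: p.-group ('N_G(U) / 'C_G(U)).
  apply: p'elts_quo_pgroup (normal_norm nsCN) _ => x Nx p'x.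
  by rewrite inE (cG U x) // (subsetP (subsetIl G 'N(U))).
have sJN: S <*> 'C_G(U) \subset 'N_G(U) by rewrite join_subG sSN (normal_sub nsCN).
rewrite -indexg_eq1; apply/eqP; apply: (@pnat_1 p).
  rewrite /pgroup card_quotient ?normal_norm // in pNC.
  exact: pnat_dvd (indexgS _ (joing_subr _ _)) pNC.
exact: pnat_dvd (indexgS _ (joing_subl _ _)) pind.
Qed.

(** Induction on the gap between [G] and the intersection [D]. Sylow p-subgroups of ['N_G(D)] above
    ['N_P(D)] and ['N_S(D)] are conjugate under ['C_G(D)]; extended to [G], they meet [P],
    respectively [S], in more than [D], because normalizers grow in p-groups. *)
Lemma p_central_Sylow_conj G P S :
    p_central G -> p.-Sylow(G) P -> p.-Sylow(G) S ->
  exists2 c, c \in 'C_G(P :&: S) & S :=: P :^ c.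
Proof.
move=> cG; move: {2}_.+1 (ltnSn (#|G| - #|P :&: S|)) => n.
elim: n P S => // n IHn P S; rewrite ltnS => lePSn sylP sylS.
have [sPS | nsPS] := boolP (P \subset S).
  exists 1; rewrite ?group1 // conjsg1; apply/eqP; rewrite eq_sym eqEcard sPS.
  by rewrite (card_Hall sylP) (card_Hall sylS) leqnn.
have nsSP: ~~ (S \subset P).
  apply: contra nsPS => sSP; suff /eqP->: P :==: S by [].
  by rewrite eq_sym eqEcard sSP (card_Hall sylP) (card_Hall sylS) leqnn.
set D := (P :&: S)%G; have pP := pHall_pgroup sylP; have pS := pHall_pgroup sylS.
have sPG := pHall_sub sylP; have sSG := pHall_sub sylS.
have sDG: D \subset G by rewrite subIset ?sPG.
have pD: p.-group D := pgroupS (subsetIl _ _) pP.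
have ltNP: D \proper 'N_P(D).
  apply: (nilpotent_proper_norm (pgroup_nil pP)).
  by rewrite properE subsetIl subsetI subxx.
have ltNS: D \proper 'N_S(D).
  apply: (nilpotent_proper_norm (pgroup_nil pS)).
  by rewrite properE subsetIr subsetI subxx andbT.
have [X sylX sNX]: {X : {group gT} | p.-Sylow('N_G(D)) X & 'N_P(D) \subset X}.
  by apply: Sylow_superset; rewrite ?setSI // (pgroupS (subsetIl _ _) pP).
have [Y sylY sNY]: {Y : {group gT} | p.-Sylow('N_G(D)) Y & 'N_S(D) \subset Y}.
  by apply: Sylow_superset; rewrite ?setSI // (pgroupS (subsetIl _ _) pS).
have [z Nz defY] := Sylow_trans sylX sylY.
have {defY} [c Cc defY]: exists2 c, c \in 'C_G(D) & Y :=: X :^ c.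
  move: Nz defY; rewrite /= -(p_central_Sylow_mul cG pD sDG sylX) => /mulsgP[x c Xx Cc ->] ->.
  by exists c; rewrite // conjsgM conjGid.
have [X1 sylX1 sXX1]: {X1 : {group gT} | p.-Sylow(G) X1 & X \subset X1}.
  apply: Sylow_superset (pHall_pgroup sylX).
  exact: subset_trans (pHall_sub sylX) (subsetIl _ _).
have lt_measure (T : {group gT}) : D \proper T -> T \subset G -> #|G| - #|T| < n.
  move=> ltDT sTG; apply: leq_trans lePSn; apply: ltn_sub2l (proper_card ltDT).
  exact: leq_trans (proper_card ltDT) (subset_leq_card sTG).
have ltD (A B : {group gT}) (C : {set gT}) :
  D \proper C -> C \subset A -> C \subset B -> D \proper A :&: B.
- by move=> ltDC sCA sCB; apply: proper_sub_trans ltDC _; rewrite subsetI sCA.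
have ltDPX : D \proper P :&: X1.
  by apply: ltD ltNP _ _; rewrite ?subsetIl ?(subset_trans sNX).
have ltPX := lt_measure (P :&: X1)%G ltDPX (subset_trans (subsetIl _ _) sPG).
have [c1 Cc1 defX1] := IHn _ _ ltPX sylP sylX1.
have Gc: c \in G by case/setIP: Cc.
have sylX1c: p.-Sylow(G) (X1 :^ c)%G by rewrite pHallJ.
have ltDXS : D \proper (X1 :^ c)%G :&: S.
  apply: ltD ltNS _ _; rewrite ?subsetIl //.
  by apply: subset_trans sNY _; rewrite defY conjSg.
have ltXS := lt_measure ((X1 :^ c)%G :&: S)%G ltDXS (subset_trans (subsetIr _ _) sSG).
have [c2 Cc2 defS] := IHn _ _ ltXS sylX1c sylS.
exists (c1 * c * c2); last by rewrite defS /= defX1 !conjsgM.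
rewrite -[P :&: S]/(gval D) !groupM //.
  by apply: subsetP Cc1; rewrite setIS ?centS ?proper_sub.
by apply: subsetP Cc2; rewrite setIS ?centS ?proper_sub.
Qed.

(** [P :^ g] and [P] share [x ^ g], so some [c] centralizing [x ^ g] carries the first to the
    second. Then [g * c] lies in ['N_G(P)], the product of ['C_G(P)] and [P], and its factor in [P]
    is the required [u]. *)
Lemma p_central_fusion G P x g :
    p_central G -> p.-Sylow(G) P -> g \in G -> x \in P -> x ^ g \in P ->
  exists2 u, u \in P & x ^ g = x ^ u.
Proof.
move=> cG sylP Gg Px Pxg.
have sylPg: p.-Sylow(G) (P :^ g)%G by rewrite pHallJ.
have [c /setIP[Gc Cc] defP] := p_central_Sylow_conj cG sylPg sylP.
have xgc: (x ^ g) ^ c = x ^ g.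
  apply/conjg_fixP/commgP/commute_sym; apply: (centP Cc).
  by rewrite inE Pxg andbT memJ_conjg.
have Nn: g * c \in 'N_G(P).
  by rewrite !inE groupM //= conjsgM {2}defP.
have sylPN: p.-Sylow('N_G(P)) P by rewrite Sylow_subnorm.
move: Nn; rewrite -(p_central_Sylow_mul cG (pHall_pgroup sylP) (pHall_sub sylP) sylPN).
rewrite -normC; last by rewrite subIset // orbC cents_norm.
case/mulsgP=> d u /setIP[_ Cd] Pu defn; exists u => //.
rewrite -xgc -conjgM defn conjgM; congr (_ ^ u).
by apply/conjg_fixP/commgP/commute_sym; apply: (centP Cd).
Qed.

(* By fusion control the transfer into P / P' is x |-> x ^ |G : P| on P, hence has kernel P'
   on P; its kernel is K. *)
Lemma p_central_transfer_ker G P :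
    p_central G -> p.-Sylow(G) P ->
  exists K : {group gT}, [/\ K <| G, p.-group (G / K) & K :&: P \subset P^`(1)].
Proof.
move=> cG sylP; have [sPG pP pind] := and3P sylP.
pose alpha := [morphism of restrm (der_norm 1 P) (coset P^`(1))].
have abA: abelian (alpha @* P).
  by rewrite morphim_restrm setIid -quotientE sub_der1_abelian.
pose V := transfer_morphism G abA.
pose f := [morphism of restrm (transfer_morph_subproof alpha) (fmod abA \o alpha)].
exists ('ker V)%G; split; first exact: ker_normal.
  rewrite /pgroup (card_isog (first_isog V)).
  apply: (@pnat_dvd _ #|[set: fmod_of abA]|); first by rewrite cardSg ?subsetT.
  have ->: [set: fmod_of abA] = fmod abA @* (alpha @* P).
    apply/eqP; rewrite eq_sym eqEsubset subsetT; apply/subsetP=> v _.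
    rewrite -(fmvalK v) mem_morphim //; exact: fmodP.
  rewrite card_injm ?injm_fmod //.
  exact: morphim_pgroup.
apply/subsetP=> g /setIP[/kerP kerg Pg].
have Gg := subsetP sPG g Pg; have {kerg} := kerg Gg.
set HG := rcosets P G; pose X := transversal (HG :* <[g]>) G.
have trX: is_transversal X (HG :* <[g]>) G.
  exact/transversalP/rcosets_cycle_partition.
rewrite /V /= (transfer_cycle_expansion sPG abA Gg trX) -/f.
(* The conjugate [g ^+ n ^ x^-1] is back in [P], hence conjugate in [P] to [g ^+ n]; as the target
   of [f] is abelian, [f] takes the same value on both. *)
have fX x : x \in X -> f (g ^+ #|<[g]> : P :* x| ^ x^-1) = (f g *+ #|<[g]> : P :* x|)%R.
  move=> Xx; set n := #|_ : _|.
  have Gx: x \in G by apply: (subsetP (transversal_sub trX)).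
  have Pgx: g ^+ n ^ x^-1 \in P.
    by have := mulg_exp_card_rcosets P g x; rewrite mem_rcoset /conjg invgK mulgA.
  have [u Pu ->] := p_central_fusion cG sylP (groupVr Gx) (groupX n Pg) Pgx.
  have fJ: f (g ^+ n ^ u) = f (g ^+ n).
    rewrite conjgE !morphM ?groupM ?groupV ?groupX // morphV //.
    by rewrite [f _ * f u]GRing.addrC; apply: mulKg.
  by rewrite fJ morphX.
set V_g := (\sum_(x in X) _)%R; have ->: V_g = (f g *+ #|G : P|)%R.
  by rewrite -(sum_index_rcosets_cycle sPG Gg trX) -GRing.sumrMnr; apply: eq_bigr.
move=> fg0.
have ofg: #[f g] %| gcdn #|G : P| #|P|.
  rewrite dvdn_gcd !order_dvdn -[_ ^+ #|P|]morphX // expg_cardG // morph1 eqxx andbT.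
  exact/eqP.
have coGP: coprime #|G : P| #|P| by rewrite coprime_sym (pnat_coprime pP).
move: ofg; rewrite (eqP coGP) dvdn1 order_eq1 => /eqP fg1.
have nPg: g \in 'N(P^`(1)) := subsetP (der_norm 1 P) g Pg.
have Aag: alpha g \in alpha @* P by apply: mem_morphim.
have ag1: alpha g = 1 by rewrite -(fmodK abA Aag) -[fmod abA _]/(f g) fg1.
exact: coset_idr ag1.
Qed.

(** Induction on the order. The derived subgroup of [P] is proper in [P], so the transfer kernel [K]
    is proper in [G]. It inherits [p_central], and [G / K] is a p-group, so the complement found in
    [K] serves for [G]. *)
Lemma p_central_p_nilpotent G : p_central G -> p_nilpotent p G.
Proof.
move: {2}_.+1 (ltnSn #|G|) => n; elim: n G => // n IHn G; rewrite ltnS => leGn cG.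
have [P sylP] := Sylow_exists p G; have [sPG pP pind] := and3P sylP.
have [P1 | ntP] := eqVneq (P : {set gT}) 1.
  apply: p'group_p_nilpotent; rewrite /pgroup -(Lagrange sPG) P1 cards1 mul1n -P1.
  exact: pind.
have [K [nsKG pGK sKP]] := p_central_transfer_ker cG sylP.
apply: (p_nilpotent_pext nsKG) pGK; apply: IHn.
  apply: leq_trans leGn; apply: proper_card.
  rewrite properEneq (normal_sub nsKG) andbT; apply: contraTneq sKP => /= ->.
  rewrite (setIidPr sPG) proper_subn //.
  by rewrite (sol_der1_proper (pgroup_sol pP)).
move=> U x pU sUK /setIP[Kx nUx] p'x.
have sKG := normal_sub nsKG.
by apply: (cG U x pU (subset_trans sUK sKG)) p'x; rewrite inE nUx (subsetP sKG).
Qed.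

(** Frobenius' criterion in its usual form: the p'-elements of a p-nilpotent ['N_G(U)] centralize
    its normal p-subgroup [U]. *)
Lemma local_p_nilpotent G :
    (forall U, U \subset G -> p.-group U -> U != 1 :> {set gT} -> p_nilpotent p 'N_G(U)) ->
  p_nilpotent p G.
Proof.
move=> locG; apply: p_central_p_nilpotent => U x pU sUG Nx p'x.
have [-> | ntU] := eqVneq (U : {set gT}) 1; first by rewrite cent1T inE.
rewrite -cycle_subG; apply: (p_nilpotent_cent (locG U sUG pU ntU) pU).
- by rewrite normalSG.
- by rewrite cycle_subG.
exact: p'x.
Qed.
End Fusion.

(** * The Thompson subgroup and quadratic action *)

Section ThompsonSubgroup.
Variable gT : finGroupType.
Implicit Types A B G : {group gT}.

Definition max_abelian (G A : {set gT}) :=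
  [&& A \subset G, abelian A
   & [forall B : {group gT}, (B \subset G) && abelian B ==> (#|B| <= #|A|)]].

Lemma max_abelianP G A :
  reflect [/\ A \subset G, abelian A
           & forall B, B \subset G -> abelian B -> #|B| <= #|A|] (max_abelian G A).
Proof.
apply: (iffP and3P) => [] [sAG abA]; last first.
  by move=> maxA; split=> //; apply/forall_inP=> B /andP[]; apply: maxA.
by move/forall_inP=> maxA; split=> // B sBG abB; apply: maxA; rewrite sBG.
Qed.

Lemma max_abelian_exists G : exists A, max_abelian G A.
Proof.
have ab1: (1%G \subset G) && abelian (1%G : {group gT}) by rewrite sub1G abelian1.
case: (@arg_maxnP _ 1%G (fun A : {group gT} => (A \subset G) && abelian A)
                       (fun A : {group gT} => #|A|) ab1) => A /andP[sAG abA] maxA.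
by exists A; apply/max_abelianP; split=> // B sBG abB; apply: maxA; rewrite sBG.
Qed.

(** This variant of the Thompson subgroup measures abelian subgroups by order rather than by rank,
    which suits the counting of offenders. *)
Definition Thompson_J (G : {set gT}) :=
  <<\bigcup_(A : {group gT} | max_abelian G A) A>>.

Canonical Thompson_J_group G := [group of Thompson_J G].

Lemma Thompson_J_max_sub G A : max_abelian G A -> A \subset Thompson_J G.
Proof. by move=> maxA; rewrite sub_gen // (bigcup_sup A). Qed.

Lemma Thompson_J_subP G (H : {group gT}) :
  reflect (forall A, max_abelian G A -> A \subset H) (Thompson_J G \subset H).
Proof. by rewrite gen_subG; apply: bigcupsP. Qed.

(** [H] contains an abelian subgroup of maximal order in [G], so the maximal orders for [G] and [H]
    agree. *)
Lemma Thompson_J_eq (G H : {group gT}) :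
  Thompson_J G \subset H -> H \subset G -> Thompson_J H = Thompson_J G.
Proof.
move=> sJH sHG; congr <<_>>; apply: eq_bigl => A.
have [A0 maxA0] := max_abelian_exists G.
have sA0H := subset_trans (Thompson_J_max_sub maxA0) sJH.
have [sA0G abA0 maxA0b] := max_abelianP _ _ maxA0.
apply/max_abelianP/max_abelianP=> [] [sA abA maxA]; split=> //.
- exact: subset_trans sA sHG.
- by move=> B sBG abB; apply: leq_trans (maxA0b B sBG abB) (maxA _ sA0H abA0).
- by apply: subset_trans sJH; apply: Thompson_J_max_sub; apply/max_abelianP.
by move=> B sBH; apply: maxA; apply: subset_trans sBH sHG.
Qed.
End ThompsonSubgroup.

Lemma Thompson_J_sub : GFunctor.closed (@Thompson_J).
Proof. by move=> gT G; apply/Thompson_J_subP=> A /max_abelianP[]. Qed.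

Lemma Thompson_J_cont : GFunctor.iso_continuous (@Thompson_J).
Proof.
move=> gT rT G f injf; rewrite /Thompson_J morphim_gen; last first.
  by apply/bigcupsP=> A /max_abelianP[].
rewrite genS //; apply/subsetP=> _ /morphimP[x Gx /bigcupP[A maxA Ax] ->].
apply/bigcupP; exists (f @* A)%G; last exact: mem_morphim.
have [sAG abA maxAb] := max_abelianP _ _ maxA.
apply/max_abelianP; split; rewrite ?morphimS ?morphim_abelian // => B sBfG abB.
rewrite card_injm // -(morphpreK (subset_trans sBfG (morphimS f (subxx G)))).
rewrite card_injm ?subsetIl //; apply: maxAb; first exact: subsetIl.
by rewrite -(injm_abelian injf) ?subsetIl // morphpreK.
Qed.

Canonical Thompson_J_igFun := [igFun by Thompson_J_sub & !Thompson_J_cont].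

Lemma Thompson_J_pgroup_neq1 (p : nat) (gT : finGroupType) (P : {group gT}) :
  p.-group P -> P :!=: 1 -> Thompson_J P != 1.
Proof.
move=> pP ntP; apply/eqP=> J1; case/eqP: ntP.
apply: (trivg_center_pgroup pP).
have [A maxA] := max_abelian_exists P.
have := Thompson_J_max_sub maxA; rewrite J1 => /trivgP A1.
have [_ _ maxAb] := max_abelianP _ _ maxA.
have leZA := maxAb _ (center_sub P) (center_abelian P).
by apply/eqP; rewrite trivg_card_le1 (leq_trans leZA) // A1 cards1.
Qed.

(** * Offenders and quadratic elements *)

Section Replacement.
Variable gT : finGroupType.
Implicit Types A P V X : {group gT}.

(* The map a |-> [v, a] induces an injection from A / B into V / 'C_V(A). *)
Lemma card_cent_commg V A v (B := 'C_A([set [~ v, a] | a in A])) :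
    abelian V -> abelian A -> A \subset 'N(V) -> v \in V ->
  #|A| * #|'C_V(A)| <= #|B| * #|'C_V(B) :&: ('C_V(A) <*> [~: V, A])|.
Proof.
move=> abV abA nVA Vv; set D := 'C_V(B) :&: _.
have sCD: 'C_V(A) \subset D.
  by rewrite subsetI joing_subl andbT setIS // centS // subsetIl.
have sBA: B \subset A := subsetIl _ _.
rewrite -(Lagrange sBA) -(Lagrange sCD) -mulnA leq_mul2l mulnC leq_mul2l.
apply/orP; right; apply/orP; right.
pose f (Bx : {set gT}) := 'C_V(A) :* [~ v, repr Bx].
have rA Bx : Bx \in rcosets B A -> repr Bx \in A.
  case/rcosetsP=> x Ax ->; case: repr_rcosetP => b Bb.
  by rewrite groupM // (subsetP sBA).
have fD Bx : Bx \in rcosets B A -> f Bx \in rcosets 'C_V(A) D.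
  move=> /rA Ar; rewrite /f -rcosetE; apply: imset_f.
  have VAv: [~ v, repr Bx] \in [~: V, A] by rewrite mem_commg.
  rewrite in_setI (subsetP (joing_subr _ _) _ VAv) andbT in_setI.
  rewrite commgEl groupM ?groupV ?memJ_norm ?(subsetP nVA) //=.
  apply/centP=> b /setIP[_ /centP cb]; apply: commute_sym; apply: cb.
  exact: imset_f.
suff injf: {in rcosets B A &, injective f}.
  rewrite -[X in X <= _](card_in_imset injf).
  apply/subset_leq_card/subsetP=> _ /imsetP[Bx ABx ->].
  exact: fD.
move=> Bx By ABx ABy fxy; move: (rA _ ABx) (rA _ ABy) fxy.
have eqB Bz : Bz \in rcosets B A -> Bz = B :* repr Bz.
  by case/rcosetsP=> z Az ->; rewrite rcoset_repr.
rewrite {3}(eqB _ ABx) {3}(eqB _ ABy) /f; move: (repr Bx) (repr By) => a b Aa Ab.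
have [nVa nVb] := (subsetP nVA a Aa, subsetP nVA b Ab).
have [Vva Vvb]: v ^ a \in V /\ v ^ b \in V by rewrite !memJ_norm.
move/rcoset_eqP; rewrite mem_rcoset => /setIP[_ cab].
apply/rcoset_eqP; rewrite mem_rcoset inE groupM ?groupV //=.
have {}cab: v ^ a * (v ^ b)^-1 \in 'C(A).
  suff <-: [~ v, a] * [~ v, b]^-1 = v ^ a * (v ^ b)^-1 by [].
  rewrite !commgEl invMg invgK mulgA -(mulgA v^-1) -(mulgA v^-1) -mulgA.
  by rewrite [X in _ * X]mulgA -(centsP abV v Vv _ (groupM Vva (groupVr Vvb))) mulKg.
(* It suffices that [a] and [b] act alike on each [[~ v, c]]. As [v ^ a * (v ^ b)^-1] commutes with
   [c], the commutators of [v ^ a] and [v ^ b] with [c] agree; since [A] is abelian, they are the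
   conjugates of [[~ v, c]] by [a] and [b]. *)
suff cabc (c : gT) : c \in A -> [~ v, c] ^ a = [~ v, c] ^ b.
  apply/centP=> _ /imsetP[c Ac ->]; apply/commute_sym/commgP/conjg_fixP.
  by rewrite conjgM cabc // conjgK.
move=> Ac; have e: (v ^ a) ^ c * ((v ^ b) ^ c)^-1 = v ^ a * (v ^ b)^-1.
  rewrite -conjVg -conjMg; apply/conjg_fixP/commgP; exact: (centP cab).
have {}e : (v ^ a)^-1 * (v ^ a) ^ c = (v ^ b)^-1 * (v ^ b) ^ c.
  by apply: (mulgI (v ^ a)); rewrite mulKVg mulgA -e mulgKV.
rewrite !commgEl !(conjMg v^-1) !conjVg -!conjgM.
by rewrite (centsP abA c Ac a Aa) (centsP abA c Ac b Ab) !conjgM.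
Qed.

(* A minimal offender X outside 'C(V) is quadratic: otherwise B := 'C_X([v, X]) < X for some v
   in V, so B centralizes V by minimality, and the counting above forces V = 'C_V(X) [V, X],
   against nilpotence. *)
Lemma quadratic_offender P V A :
    nilpotent P -> V <| P -> abelian V -> A \subset P -> abelian A ->
    ~~ (A \subset 'C(V)) -> #|'C_A(V)| * #|V| <= #|A| * #|'C_V(A)| ->
  exists x, [/\ x \in A, x \notin 'C(V) & forall v, v \in V -> [~ v, x, x] = 1].
Proof.
move=> nilP /andP[sVP nVP] abV sAP abA ncAV offA.
pose offender (X : {group gT}) :=
  [&& X \subset A, ~~ (X \subset 'C(V)) & #|'C_A(V)| * #|V| <= #|X| * #|'C_V(X)|].
have [X minX _]: {X : {group gT} | mingroup X offender & X \subset A}.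
  by apply: mingroup_exists; apply/and3P.
have {minX} [/and3P[sXA ncXV offX] minX] := mingroupP minX.
have abX := abelianS sXA abA; have sXP := subset_trans sXA sAP.
have nVX := subset_trans sXP nVP.
have [x Xx ncx] := subsetPn ncXV; exists x; split=> //; first exact: (subsetP sXA).
move=> v Vv; have := card_cent_commg abV abX nVX Vv.
set B := 'C_X(_); have [defB | neB] := eqVneq B X.
  move=> _; have := Xx; rewrite -defB => /setIP[_ /centP cx].
  by apply/eqP/commgP/commute_sym/cx/imset_f.
set W := 'C_V(X) <*> _ => leXB.
have sBX: B \subset X by apply: subsetIl.
have sWV: W \subset V by rewrite join_subG subsetIl commg_subl.
have sIV : 'C_V(B) :&: W \subset 'C_V(B) by apply: subsetIl.
have cBV: B \subset 'C(V).
  apply: contraR neB => ncBV; apply/eqP; apply: (minX [group of B]) => //=.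
  apply/and3P; split=> //; first exact: subset_trans sBX sXA.
  by apply: leq_trans offX (leq_trans leXB _); rewrite leq_mul2l subset_leq_card ?orbT.
have sBC: B \subset 'C_A(V) by rewrite subsetI (subset_trans sBX sXA).
have: #|'C_A(V)| * #|V| <= #|'C_A(V)| * #|W|.
  apply: leq_trans offX (leq_trans leXB _).
  by rewrite leq_mul ?subset_leq_card ?subsetIr.
rewrite leq_pmul2l ?cardG_gt0 // => leVW.
have defV: W = V by apply/eqP; rewrite eqEcard sWV.
have nVXX: X \subset 'N([~: V, X]) by apply: commg_normr.
have [VX1 | ntVX] := eqVneq [~: V, X] 1.
  by case/negP: ncXV; rewrite centsC; apply/commG1P.
have := nil_comm_properl nilP (subset_trans _ sVP) ntVX.
move/(_ X); rewrite commg_subl nVX subsetI sXP nVXX => /(_ isT isT).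
rewrite properE => /andP[_ /negP[]].
(* By [W = V], each [w] is [c * u] with [c] centralized by [X] and [u] in [[~: V, X]], so that
   [[~ w, y] = [~ u, y]]. *)
rewrite gen_subG; apply/subsetP=> _ /imset2P[w y Vw Xy ->].
move: Vw; rewrite -{1}defV /W norm_joinEl; last first.
  by apply: subset_trans (commg_norml _ _); apply: subsetIl.
case/mulsgP=> c u /setIP[_ /centP cc] uVX ->.
by rewrite commMgJ (eqP (introT commgP (cc y Xy))) conj1g mul1g mem_commg.
Qed.
End Replacement.

(** * Quadratic action on modules without 2-torsion *)

Section QuadraticAction.
Import GRing.Theory.
Local Open Scope ring_scope.

(* Y and 1 + T are the actions of y and x; the two commutation hypotheses say that Y commutes
   with its conjugates by x and x^-1 = 1 - T. Their difference shows that Y commutes with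
   Z = T Y - Y T, whence T Y^m = Y^m T + m Y^(m - 1) Z. *)
Lemma quadratic_comm_additive (M : zmodType) (Y T : {additive M -> M}) (m : nat) :
    (forall v : M, v *+ 2 = 0 -> v = 0) -> (forall v : M, v *+ m = 0 -> v = 0) ->
    (0 < m)%N -> (forall v, iter m Y v = v) ->
    (forall v, Y (Y (v - T v) + T (Y (v - T v))) =
               Y (Y v - T (Y v)) + T (Y (Y v - T (Y v)))) ->
    (forall v, Y (Y (v + T v) - T (Y (v + T v))) =
               Y (Y v + T (Y v)) - T (Y (Y v + T (Y v)))) ->
  forall v, T (Y v) = Y (T v).
Proof.
move=> tf2 tfm m_gt0 Ym comm1 comm2.
pose Z v := T (Y v) - Y (T v).
have YZ v : Y (Z v) = Z (Y v).
  have := comm1 v; have := comm2 v; rewrite !(raddfD, raddfN) /=.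
  set P := Y (T (Y v)); set Q := Y (Y (T v)); set R := T (Y (Y v)).
  set e := Y (T (Y (T v))); set f := T (Y (T (Y v))); set A := Y (Y v).
  move=> e2 e1; apply/eqP; rewrite -subr_eq0; apply/eqP/tf2.
  rewrite -[Z (Y v)]/(R - P).
  have acb (a b c d : M) : a - b + (c - d) = a + (c - b - d).
    by rewrite -!addrA; congr (a + _); apply: addrCA.
  have {}e1 : P - Q - e = R - P - f by apply: (addrI A); rewrite -!acb.
  have {}e2 : Q - P - e = P - R - f.
    by apply: (addrI A); move: e2; rewrite -!addrA.
  (* [Y (Z v) - Z (Y v)] and its opposite both equal [e - f], so its double vanishes. *)
  have d1 : (P - Q) - (R - P) = e - f.
    apply/eqP; rewrite subr_eq addrAC -subr_eq; apply/eqP.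
    by rewrite opprK -[P - Q](subrK e) e1 addrAC subrK addrC.
  have d2 : (R - P) - (P - Q) = e - f.
    rewrite opprB -[Q - P](subrK e) e2 -[P - R]opprB; move: (R - P) => D.
    by rewrite !addrA subrr add0r addrC.
  by rewrite mulr2n {1}d1 -d2 -[R - P - _]opprB addNr.
have ZY k v : Z (iter k Y v) = iter k Y (Z v).
  by elim: k => //= k IHk; rewrite -YZ IHk.
have TY k v : T (iter k.+1 Y v) = iter k.+1 Y (T v) + iter k Y (Z v) *+ k.+1.
  elim: k v => [|k IHk] v; first by rewrite /= /Z mulr1n addrC subrK.
  have -> : T (iter k.+2 Y v) = Z (iter k.+1 Y v) + Y (T (iter k.+1 Y v)).
    by rewrite /Z /= subrK.
  by rewrite ZY IHk raddfD raddfMn addrCA -mulrS.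
(* With [m = k + 1] and [Y^m = 1], the formula reads [T v = T v + m Y^k (Z v)]. Hence
   [Y^k (Z v) = 0], and one more [Y] gives [Z v = 0]. *)
case: m m_gt0 tfm Ym => // k _ tfk Yk v.
have /eqP := TY k v; rewrite !Yk -[X in X == _]addr0 (inj_eq (addrI _)) eq_sym => /eqP/tfk Z0.
apply/eqP; rewrite -subr_eq0 -/(Z v) -(Yk (Z v)) /= Z0.
by rewrite raddf0.
Qed.
End QuadraticAction.

Section QuadraticGroup.
Import GRing.Theory.
Variables (gT : finGroupType) (V : {group gT}).
Hypothesis abV : abelian V.
Implicit Types x y : gT.

Local Notation "u ^@ x" := (actr u x) (at level 31, left associativity).

Lemma fmod_torsion_free m (v : fmod_of abV) :
  coprime #|V| m -> (v *+ m = 0)%R -> v = 0%R.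
Proof.
move=> coVm vm0; apply: fmod_inj; rewrite fmval0.
apply/eqP; rewrite -order_eq1 -dvdn1 -(eqP coVm) dvdn_gcd order_dvdG ?fmodP //=.
by rewrite order_dvdn -fmvalZ vm0.
Qed.

Lemma actr_cent (u : fmod_of abV) c : c \in 'C(V) -> u ^@ c = u.
Proof.
move=> cc; apply: fmod_inj; rewrite fmvalJ ?(subsetP (cent_sub V)) //.
by apply/conjg_fixP/commgP; apply/commute_sym/(centP cc)/fmodP.
Qed.

Definition fmod_act z (u : fmod_of abV) := u ^@ z.

Lemma fmod_act_is_zmod_morphism z : zmod_morphism (fmod_act z).
Proof. by move=> u v; rewrite /fmod_act actAr actNr. Qed.

HB.instance Definition _ z := GRing.isZmodMorphism.Build
  (fmod_of abV) (fmod_of abV) (fmod_act z) (fmod_act_is_zmod_morphism z).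

(** In additive terms [x] acts on [V] as [1 + T], and quadratic action makes [T^2 = 0], so [x^-1]
    acts as [1 - T]. Odd order and coprimality exclude 2-torsion and m-torsion. That [T] commutes
    with [Y] means that [x * y] and [y * x] act alike on [V]. *)
Lemma quadratic_comm x y m :
    odd #|V| -> x \in 'N(V) -> y \in 'N(V) ->
    (forall v, v \in V -> [~ v, x, x] = 1) ->
    coprime #|V| m -> 0 < m -> y ^+ m \in 'C(V) ->
    [~ y, y ^ x] \in 'C(V) -> [~ y, y ^ x^-1] \in 'C(V) ->
  [~ y, x] \in 'C(V).
Proof.
move=> oddV nVx nVy quad coVm m_gt0 cym cyx cyx'.
pose M := fmod_of abV; pose Y : {additive M -> M} := fmod_act y.
pose T : {additive M -> M} := (fmod_act x \- idfun)%R.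
have actT (u : M) : (u + T u)%R = u ^@ x by rewrite addrC subrK.
have T2 (u : M) : (T u) ^@ x = T u.
  apply: fmod_inj; rewrite fmvalJ //.
  have valT: fmval (T u) = [~ fmval u, x].
    rewrite commgEl -fmvalJ // -[LHS]/(val (u ^@ x) * (val u)^-1).
    by rewrite (centsP abV) ?groupV ?fmodP.
  by rewrite -[val _]/(fmval (T u)) valT; apply/conjg_fixP/eqP; rewrite quad ?fmodP.
have actT' (u : M) : (u - T u)%R = u ^@ x^-1.
  by apply: (canRL (actrK x)); rewrite actAr actNr T2 -actT addrK.
have actC z t (u : M) : z \in 'N(V) -> t \in 'N(V) -> [~ z, t] \in 'C(V) ->
  u ^@ z ^@ t = u ^@ t ^@ z.
- move=> nz nt czt; rewrite -!actrM // commgC.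
  rewrite (actrM (groupM nt nz) (subsetP (cent_sub V) _ czt)).
  exact: actr_cent.
have YT : forall v, T (Y v) = Y (T v).
  apply: (@quadratic_comm_additive M Y T m) => //.
  - by move=> v; apply: fmod_torsion_free; rewrite coprimen2.
  - by move=> v; apply: fmod_torsion_free.
  - move=> v; have ->: iter m Y v = v ^@ (y ^+ m).
      elim: m {m_gt0 coVm cym} => [|k IHk]; first by rewrite actr1.
      by rewrite expgSr actrM ?groupX //= IHk.
    exact: actr_cent.
  - move=> v; rewrite !actT' !actT /=.
    have actJ (u : M) : u ^@ x^-1 ^@ y ^@ x = u ^@ (y ^ x).
      by rewrite conjgE mulgA !actrM ?groupM ?groupV.
    by rewrite !actJ actC ?groupJ // -[[~ _, _]]invgK invg_comm groupV.
  move=> v; rewrite !actT !actT' /=.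
  have actJ (u : M) : u ^@ x ^@ y ^@ x^-1 = u ^@ (y ^ x^-1).
    by rewrite conjgE invgK mulgA !actrM ?groupM ?groupV.
  by rewrite !actJ actC ?groupJ ?groupV // -[[~ _, _]]invgK invg_comm groupV.
have actYX (u : M) : u ^@ (y * x) = u ^@ (x * y).
  rewrite !actrM //.
  have eYT: (u ^@ y ^@ x - u ^@ y = (u ^@ x - u) ^@ y)%R := YT u.
  by rewrite actAr actNr in eYT; apply: addIr eYT.
have conjYX w : w \in V -> w ^ (y * x) = w ^ (x * y).
  move=> Vw; have := congr1 val (actYX (fmod abV w)).
  by rewrite (fmvalJ _ (groupM nVy nVx)) (fmvalJ _ (groupM nVx nVy)) fmodK.
apply/centP=> z Vz; apply/commute_sym/commgP/conjg_fixP.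
have Vz': z ^ (x * y)^-1 \in V by rewrite memJ_norm ?groupV ?groupM.
by rewrite -{1}[z](conjgKV (x * y)) -conjgM -commgC conjYX // conjgKV.
Qed.

(* For v in V, the sum of v over each conjugate <[a]> :^ y, y in Q, is fixed by a ^ y, hence 0.
   As a ^ y runs over the coset a Q, summing over y shows that #|Q| v is fixed by Q. *)
Lemma cent_prime_fpf (Q : {group gT}) a :
    prime #[a] -> a \in 'N(V) -> a \in 'N(Q) -> Q \subset 'N(V) ->
    'C_V[a] = 1 -> 'C_Q[a] = 1 -> coprime #|V| #|Q| ->
  Q \subset 'C(V).
Proof.
move=> pr_a nVa nQa nVQ cVa cQa coVQ; pose M := fmod_of abV.
have nVA c : c \in <[a]> -> c \in 'N(V).
  by apply/subsetP; rewrite cycle_subG.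
have nQA c : c \in <[a]> -> c \in 'N(Q).
  by apply/subsetP; rewrite cycle_subG.
have {}nVQ y : y \in Q -> y \in 'N(V) := subsetP nVQ y.
have sum_conj0 (v : M) y : y \in Q -> (\sum_(c in <[a]>) v ^@ (c ^ y) = 0)%R.
  move=> Qy; set s := (\sum_(c in _) _)%R.
  have fix_s : s ^@ (a ^ y) = s.
    rewrite actr_sum /s [RHS](reindex_inj (mulIg a)) /=.
    apply: eq_big => [c | c Ac]; first by rewrite groupMr ?cycle_id.
    have nVay : a ^ y \in 'N(V) by rewrite groupJ // nVQ.
    have nVcy : c ^ y \in 'N(V) by rewrite groupJ ?(nVA c) // nVQ.
    by rewrite (conjMg c) (actrM nVcy nVay).
  suff: fmval s ^ y^-1 \in 'C_V[a].
    rewrite cVa => /set1P s1; apply: fmod_inj.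
    by apply: (conjg_inj y^-1); rewrite s1 conj1g.
  rewrite inE memJ_norm ?groupV ?nVQ ?fmodP //=.
  apply/cent1P/commgP/conjg_fixP.
  have nVay : a ^ y \in 'N(V) by rewrite groupJ // nVQ.
  rewrite -[in RHS]fix_s (fmvalJ _ nVay) -!conjgM; congr (_ ^ _).
  by rewrite conjgE !mulgA mulgK.
have cQc c : c \in <[a]> -> c != 1 -> 'C_Q[c] = 1.
  move=> Ac ntc; apply/trivgP; rewrite -cQa setIS //.
  have oc: #[c] = #[a] by apply: nt_prime_order => //; apply: expg_cardG.
  have eq_ca: <[c]> = <[a]> by apply/eqP; rewrite eqEcard cycle_subG Ac -!orderE oc /=.
  by rewrite /= -!cent_cycle eq_ca.
(* Since [c ^ y = c * [~ c, y]], this holds because [y |-> [~ c, y]] permutes [Q], [c] having no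
   nontrivial fixed point there. *)
have sum_shift (v : M) c : c \in <[a]> -> c != 1 ->
  (\sum_(y in Q) v ^@ (c ^ y) = \sum_(z in Q) v ^@ (c * z)%g)%R.
- move=> Ac ntc.
  have injh: {in Q &, injective (fun y => [~ c, y])}.
    move=> y z Qy Qz; rewrite !commgEl => /mulgI eq_cyz.
    suff: y * z^-1 \in 'C_Q[c] by rewrite cQc // => /set1P/(canRL (mulgKV _)); rewrite mul1g.
    rewrite inE groupM ?groupV //=; apply/cent1P/commute_sym/commgP/conjg_fixP.
    by rewrite conjgM eq_cyz conjgK.
  have hQ: [set [~ c, y] | y in Q] = Q.
    apply/eqP; rewrite eqEcard card_in_imset // leqnn andbT.
    apply/subsetP=> _ /imsetP[y Qy ->].
    by rewrite commgEr groupM // memJ_norm ?groupV ?nQA.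
  by rewrite -[in RHS]hQ big_imset //=; apply: eq_bigr => y Qy; rewrite commgEl mulKVg.
(* In the double sum over [<[a]>] and [Q] the terms with [c = 1] add up to [#|Q|] times [v]; the
   others run over cosets [c Q], which right multiplication by [q] permutes. *)
have fixQ (v : M) q : q \in Q -> (v *+ #|Q|)%R ^@ q = (v *+ #|Q|)%R.
  move=> Qq; pose R := (\sum_(c in <[a]> | c != 1%g) \sum_(z in Q) v ^@ (c * z)%g)%R.
  have ->: (v *+ #|Q| = - R)%R.
    apply/eqP; rewrite -addr_eq0; apply/eqP.
    have: (\sum_(c in <[a]>) \sum_(y in Q) v ^@ (c ^ y) = 0)%R.
      by rewrite exchange_big big1 // => y Qy; apply: sum_conj0.
    rewrite (bigD1 1) //= => sum0; rewrite -[RHS]sum0; congr (_ + _)%R.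
      by rewrite -sumr_const; apply: eq_bigr => y _; rewrite conj1g actr1.
    by apply: eq_bigr => c /andP[Ac ntc]; rewrite sum_shift.
  rewrite actNr actr_sum; congr (- _)%R; apply: eq_bigr => c /andP[Ac _].
  rewrite actr_sum [RHS](reindex_inj (mulIg q)) /=.
  apply: eq_big => [z | z Qz]; first by rewrite groupMr.
  by rewrite mulgA [RHS]actrM ?groupM ?(nVA c) ?nVQ.
apply/subsetP=> q Qq; apply/centP=> z Vz; apply/commute_sym/commgP/conjg_fixP.
have: (fmod abV z ^@ q - fmod abV z = 0)%R.
  by apply: (@fmod_torsion_free #|Q|) => //; rewrite mulrnBl -actZr fixQ ?subrr.
move/(canRL (subrK _)); rewrite add0r => /(congr1 val).
by rewrite fmvalJ ?nVQ // fmodK.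
Qed.
End QuadraticGroup.

(** * Thompson's normal p-complement theorem *)

Section NormalizerControl.
Variable (p : nat).

(** A Frattini argument: if [coset D x] normalizes [P / D], then [P] and [P :^ x] are Sylow in
    [P <*> D], so an element of [D] corrects [x] to normalize [P]. *)
Lemma quotient_subnorm_pgroup (gT : finGroupType) (G D P : {group gT}) :
    D <| G -> p^'.-group D -> P \subset G -> p.-group P ->
  'N_(G / D)(P / D) \subset 'N_G(P) / D.
Proof.
move=> /andP[sDG nDG] p'D sPG pP; apply/subsetP=> _ /setIP[/morphimP[x nDx Gx ->] nPx].
have nDP := subset_trans sPG nDG.
have sylP: p.-Sylow(P <*> D) P.
  by case: (coprime_mulpG_Hall (esym (norm_joinEl nDP)) pP p'D).
have sylPx: p.-Sylow(P <*> D) (P :^ x)%G.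
  rewrite pHallE cardJg (card_Hall sylP) eqxx andbT /=.
  rewrite -(quotientSGK _ (joing_subr P D)) ?quotientYidr //; last first.
    by rewrite -(normP nDx) normJ conjSg.
  by rewrite quotientJ // (normP nPx).
have [y] := Sylow_trans sylP sylPx.
rewrite /= norm_joinEl // => /mulsgP[u d Pu Dd ->] defPx.
have nPxd: x * d^-1 \in 'N_G(P).
  rewrite !inE groupM // ?groupV ?(subsetP sDG) //= conjsgM.
  by rewrite [P :^ x]defPx conjsgM (conjGid Pu) conjsgK.
have -> : coset D x = coset D (x * d^-1).
  have nDd: d^-1 \in 'N(D) by rewrite groupV (subsetP (normG D)).
  by rewrite morphM //= (coset_id (groupVr Dd)) mulg1.
by apply: mem_quotient.
Qed.

Variable F : GFunctor.iso_map.

(** [F] stays abstract because the hypothesis is used twice, for the Thompson subgroup and for the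
    center. *)
Definition norm_p_nilpotent (gT : finGroupType) (G : {set gT}) :=
  forall R : {group gT}, p.-Sylow(G) R -> p_nilpotent p 'N_G(F gT R).

Lemma norm_p_nilpotentS (gT : finGroupType) (G H R : {group gT}) :
    H \subset G -> p.-Sylow(G) R -> R \subset H ->
  norm_p_nilpotent G -> norm_p_nilpotent H.
Proof.
move=> sHG sylR sRH nG S sylS.
have sylRH := pHall_subl sRH sHG sylR.
have sylSG: p.-Sylow(G) S.
  rewrite pHallE (subset_trans (pHall_sub sylS)) //=.
  by rewrite (card_Hall sylS) -(card_Hall sylRH) (card_Hall sylR).
by apply: p_nilpotentS (nG S sylSG); apply: setSI.
Qed.

Lemma norm_p_nilpotent_conj (gT : finGroupType) (G R : {group gT}) :
    p.-Sylow(G) R -> p_nilpotent p 'N_G(F gT R) -> norm_p_nilpotent G.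
Proof.
move=> sylR nR S sylS; have [x Gx defS] := Sylow_trans sylR sylS.
have -> : F gT S = F gT R :^ x.
  have nRx: R \subset 'dom (conjgm_morphism R x) by [].
  have := injmF F (injm_conj R x) (subxx R).
  by rewrite !morphim_conj setIid (setIidPr (gFsub F R)) -defS => ->.
by rewrite normJ -{1}(conjGid Gx) -conjIg p_nilpotentJ.
Qed.

(** The quotient map is injective on [R], so it carries [F gT R] to the value of [F] at [R / D],
    whose normalizer lifts by the Frattini argument. *)
Lemma norm_p_nilpotent_p'quo (gT : finGroupType) (G D : {group gT}) :
    D <| G -> p^'.-group D -> norm_p_nilpotent G -> norm_p_nilpotent (G / D).
Proof.
move=> nsDG p'D nG; have [R sylR] := Sylow_exists p G.
have nDR: R \subset 'N(D) := subset_trans (pHall_sub sylR) (normal_norm nsDG).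
apply: (norm_p_nilpotent_conj (quotient_pHall nDR sylR)).
have pR := pHall_pgroup sylR.
have injD: 'injm (restrm nDR (coset D)).
  by rewrite ker_restrm ker_coset (coprime_TIg (pnat_coprime pR p'D)).
have := injmF F injD (subxx R).
rewrite !morphim_restrm setIid (setIidPr (gFsub F R)) /= => <-.
have sFG: F gT R \subset G := subset_trans (gFsub F R) (pHall_sub sylR).
apply: p_nilpotentS (quotient_subnorm_pgroup nsDG p'D sFG (pgroupS (gFsub F R) pR)) _.
apply: p_nilpotent_quo (nG R sylR).
by apply: subset_trans (subsetIl _ _) (normal_norm nsDG).
Qed.
End NormalizerControl.

(** * The minimal counterexample to Thompson's theorem *)

Section MinimalCounterexample.
Variables (p : nat) (gT : finGroupType) (G : {group gT}).
Hypothesis odd_p : odd p.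
Let J := Thompson_J_igFun.
Let Z := [igFun of @center].
Hypothesis IH : forall (rT : finGroupType) (H : {group rT}),
  #|H| < #|G| -> norm_p_nilpotent p J H -> norm_p_nilpotent p Z H -> p_nilpotent p H.
Hypotheses (nJ : norm_p_nilpotent p J G) (nZ : norm_p_nilpotent p Z G).
Hypothesis not_pnG : ~~ p_nilpotent p G.
Implicit Types H K U R S : {group gT}.

Lemma mincex_sub H R : p.-Sylow(G) R -> R \subset H -> H \proper G -> p_nilpotent p H.
Proof.
move=> sylR sRH ltHG; have sHG := proper_sub ltHG.
apply: IH; first exact: proper_card.
  exact: norm_p_nilpotentS sHG sylR sRH nJ.
exact: norm_p_nilpotentS sHG sylR sRH nZ.
Qed.

(** By Frobenius some p-subgroup [U] is bad; choose it with the p-part of [#|'N_G(U)|] maximal. If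
    ['N_G(U)] were proper, it would satisfy the hypotheses: where its Sylow subgroup [S] is not
    Sylow in [G], [S] grows in its normalizer, so the normalizer of [F gT S] has larger p-part and
    is p-nilpotent by the choice of [U]. *)
Lemma mincex_pcore_neq1 : 'O_p(G) != 1.
Proof.
pose bad U := [&& U \subset G, p.-group U, U != 1%G & ~~ p_nilpotent p 'N_G(U)].
have [U0 badU0]: exists U, bad U.
  apply/existsP; apply: contraR not_pnG => /existsPn noU.
  apply: local_p_nilpotent => U sUG pU ntU; have := noU U.
  by rewrite /bad sUG pU -val_eqE ntU negbK.
have [U badU maxU] := @arg_maxnP _ U0 bad (fun U => #|'N_G(U)|`_p)%N badU0.
have {badU} [sUG pU ntU npnU] := and4P badU.
suff nsUG: U <| G.
  apply: contraNneq ntU => O1; rewrite -val_eqE -subG1 -O1.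
  by rewrite pcore_max.
rewrite /normal sUG; apply: contraR npnU => not_nUG.
have ltNG: 'N_G(U) \proper G by rewrite properE subsetIl subsetI subxx.
suff nF (F : GFunctor.iso_map) : norm_p_nilpotent p F G ->
    (forall S, p.-group S -> S != 1%G -> F gT S != 1) -> norm_p_nilpotent p F 'N_G(U).
  apply: IH; first exact: proper_card.
    by apply: nF nJ _ => S pS ntS; apply: Thompson_J_pgroup_neq1 pS _.
  apply: nF nZ _ => S pS; apply: contraNneq => /(trivg_center_pgroup pS) S1.
  exact/eqP/val_inj.
move=> nFG ntF S sylS; have [sSN pS _] := and3P sylS.
have sSG: S \subset G := subset_trans sSN (subsetIl _ _).
have [R sylR sSR] := Sylow_superset sSG pS.
have [eqSR | neSR] := eqVneq S R.
  by rewrite eqSR; apply: p_nilpotentS (nFG R sylR); rewrite setSI ?subsetIl.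
have ltSR: S \proper 'N_R(S).
  by apply: (nilpotent_proper_norm (pgroup_nil (pHall_pgroup sylR))); rewrite properEneq neSR.
have ntS: S != 1%G.
  apply: contraNneq ntU => S1; rewrite -val_eqE -subG1 -[1]/(gval 1%G) -S1.
  have nsUN: U <| 'N_G(U) by rewrite normalSG.
  exact: subset_trans (pcore_max pU nsUN) (pcore_sub_Hall sylS).
have pF: p.-group (F gT S) := pgroupS (gFsub F S) pS.
have sFG: F gT S \subset G := subset_trans (gFsub F S) sSG.
apply: (@p_nilpotentS _ _ 'N_G(F gT S)); first by rewrite setSI ?subsetIl.
apply: contraT => npnF.
have badF: bad (gFgroup F S) by rewrite /bad sFG pF npnF andbT /= -val_eqE ntF.
have leN: (#|'N_G(F gT S)|`_p <= #|'N_G(U)|`_p)%N := maxU _ badF.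
move: leN; rewrite leqNgt => /negP[]; rewrite -(card_Hall sylS).
apply: leq_trans (proper_card ltSR) _.
have pNR: p.-group 'N_R(S) := pgroupS (subsetIl _ _) (pHall_pgroup sylR).
rewrite -(part_pnat_id pNR) dvdn_leq ?partn_dvd ?cardG_gt0 //= cardSg //.
by rewrite setISS ?(pHall_sub sylR) ?gFnorms.
Qed.

Lemma mincex_p'core_eq1 : 'O_p^'(G) = 1.
Proof.
apply/eqP; apply: contraR not_pnG => ntO.
have nsOG := pcore_normal p^' G; have p'O := pcore_pgroup p^' G.
apply: (p_nilpotent_p'quo nsOG p'O); apply: IH.
- by rewrite ltn_quotient ?pcore_sub.
- exact: norm_p_nilpotent_p'quo.
exact: norm_p_nilpotent_p'quo.
Qed.

Let U := 'O_p(G)%G.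

Lemma mincex_norm_nontriv (F : GFunctor.iso_map) R :
  norm_p_nilpotent p F G -> p.-Sylow(G) R -> ~~ (F gT R <| G).
Proof.
move=> nF sylR; apply: contra not_pnG => /andP[_ nFG].
by have := nF R sylR; rewrite (setIidPl nFG).
Qed.

Lemma mincex_Sylow_neq R : p.-Sylow(G) R -> U != R.
Proof.
move=> sylR; apply: contraNneq (mincex_norm_nontriv nZ sylR) => <-.
exact/gFnormal_trans/pcore_normal.
Qed.

(** The value of [F] at [R / U] is [Y / U] for a p-group [Y] larger than [U]. Such a [Y] is not
    normal in [G], so ['N_G(Y)], which contains [R], is p-nilpotent by minimality. *)
Lemma mincex_quo_p_nilpotent : p_nilpotent p (G / U).
Proof.
have nsUG: U <| G := pcore_normal p G.
suff nF (F : GFunctor.iso_map) :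
    (forall (rT : finGroupType) (S : {group rT}), p.-group S -> S :!=: 1 -> F rT S != 1) ->
  norm_p_nilpotent p F (G / U).
  apply: IH; first by rewrite ltn_quotient ?pcore_sub ?mincex_pcore_neq1.
    by apply: nF => rT S; apply: Thompson_J_pgroup_neq1.
  by apply: nF => rT S pS; apply: contraNneq => /(trivg_center_pgroup pS) ->.
move=> ntF; have [R sylR] := Sylow_exists p G.
have [sRG pR _] := and3P sylR.
have sUR: U \subset R := pcore_sub_Hall sylR.
have nUR := subset_trans sRG (normal_norm nsUG).
have sylRU := quotient_pHall nUR sylR.
apply: (norm_p_nilpotent_conj sylRU).
have ntRU: R / U != 1.
  apply: contraNneq (mincex_Sylow_neq sylR) => RU1.
  by rewrite -val_eqE eqEsubset sUR -quotient_sub1 // RU1 /=.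
have ntFU := ntF _ _ (pHall_pgroup sylRU) ntRU.
have nsUR: U <| R by rewrite /normal sUR.
have [Y defY sUY sYR] := inv_quotientS nsUR (gFsub F (R / U)%G).
have nsUY: U <| Y := normalS sUY sYR nsUR.
rewrite /= defY -(quotient_subnormG _ nsUY).
have sRN: R \subset 'N_G(Y).
  rewrite subsetI sRG -(quotientSGK nUR) ?(subset_trans sUY (normG Y)) //.
  by rewrite quotient_normG // -defY gFnorm.
apply: p_nilpotent_quo; first exact: subset_trans (subsetIl _ _) (normal_norm nsUG).
apply: mincex_sub sylR sRN _; rewrite properE subsetIl /=.
apply: contra ntFU => sGN; rewrite /= defY; apply/eqP/trivgP.
rewrite quotient_sub1 ?(normal_norm nsUY) // pcore_max ?(pgroupS sYR) //.
rewrite /normal (subset_trans sYR) //.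
by apply: subset_trans sGN (subsetIr _ _).
Qed.

(** A p'-element normalizing a p-subgroup [W] of [C] centralizes [U], and centralizes [W] modulo [U]
    as [G / U] is p-nilpotent; by coprime action it centralizes [W]. So [C] is p-nilpotent with
    trivial p'-core, that is, a normal p-subgroup. *)
Lemma mincex_cent : 'C_G(U) \subset U.
Proof.
have nsUG: U <| G := pcore_normal p G; have [sUG nUG] := andP nsUG.
set C := 'C_G(U); have nsCG: C <| G.
  by have := subcent_normal G U; rewrite (setIidPl nUG).
have pU: p.-group U := pcore_pgroup p G.
have cC: p_central p C.
  move=> W x pW sWC /setIP[Cx nWx] p'x; have [Gx cUx] := setIP Cx.
  have sWG: W \subset G := subset_trans sWC (subsetIl _ _).
  set A := <[x]>; have nWA: A \subset 'N(W) by rewrite cycle_subG.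
  have sAG: A \subset G by rewrite cycle_subG.
  have p'A: p^'.-group A := p'x.
  have cUA: A \subset 'C(U) by rewrite cycle_subG.
  have [nUW nUA] := (subset_trans sWG nUG, subset_trans sAG nUG).
  have cWA: [~: W, A] \subset U.
    rewrite -quotient_cents2 // centsC.
    have pnWA: p_nilpotent p ((W <*> A) / U).
      by apply: p_nilpotentS mincex_quo_p_nilpotent; rewrite quotientS // join_subG sWG.
    apply: (p_nilpotent_cent pnWA).
    - exact: quotient_pgroup.
    - by rewrite quotient_normal // normalYl.
    - by rewrite quotientS // joing_subr.
    exact: quotient_pgroup.
  pose I := (W :&: U)%G; have sIW: I \subset W := subsetIl W U.
  have cIA: A \subset 'C(I) by rewrite (subset_trans cUA) // centS ?subsetIr.
  have pI: p.-group I := pgroupS sIW pW.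
  have nIW: W \subset 'N(I) by rewrite normsI ?normG.
  have coIA: coprime #|I| #|A| := pnat_coprime pI p'A.
  have := coprime_norm_quotient_cent nWA (cents_norm cIA) coIA (pgroup_sol pI).
  have /setIidPl->: W / I \subset 'C(A / I).
    by rewrite quotient_cents2 ?(cents_norm cIA) // subsetI commg_subl nWA.
  move=> defWI; rewrite -cycle_subG centsC.
  suff: W \subset 'C_W(A) by rewrite subsetI => /andP[].
  by rewrite -(quotientSGK nIW) ?defWI // subsetI sIW centsC.
have pnC := p_central_p_nilpotent cC.
have pC: p.-group C.
  have O1: 'O_p^'(C) = 1.
    apply/trivgP; rewrite -mincex_p'core_eq1 pcore_max ?pcore_pgroup //.
    exact: gFnormal_trans.
  by have /and3P[_ _] := pnC; rewrite O1 indexg1 pnatNK.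
by rewrite pcore_max.
Qed.

(** [H / U] is a minimal [R / U]-invariant subgroup of the p'-core of [G / U]; coprime action gives
    it an invariant Sylow subgroup, whence it is abelian. If [H <*> R] were proper, it would be
    p-nilpotent, and the p'-elements of [H] would centralize [U], against [mincex_cent]. *)
Lemma mincex_structure R : p.-Sylow(G) R ->
  exists H, [/\ U \subset H, H <| G, H * R = G, p^'.-group (H / U)
             & abelian (H / U) /\ minnormal (H / U) (R / U)].
Proof.
move=> sylR; have nsUG: U <| G := pcore_normal p G; have [sUG nUG] := andP nsUG.
have [sRG pR _] := and3P sylR.
have sUR: U \subset R := pcore_sub_Hall sylR.
have nUR := subset_trans sRG nUG.
have ntK: 'O_p^'(G / U) != 1.
  apply: contra not_pnG => /eqP O1; apply: pgroup_p_nilpotent.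
  have /and3P[_ _] := mincex_quo_p_nilpotent; rewrite O1 indexg1 pnatNK => pGU.
  by rewrite -(pquotient_pgroup (pcore_pgroup p G) nUG).
have nKR: R / U \subset 'N('O_p^'(G / U)).
  by apply: subset_trans (gFnorm _ _); apply: quotientS.
have [Q minQ sQK] := minnormal_exists ntK nKR.
have p'Q: p^'.-group Q := pgroupS sQK (pcore_pgroup _ _).
have [/andP[ntQ nQR] minQ'] := mingroupP minQ.
have pRU: p.-group (R / U) := quotient_pgroup U pR.
have coQR: coprime #|Q| #|R / U| by rewrite coprime_sym (pnat_coprime pRU p'Q).
have [q q_pr q_dv]: exists2 q, prime q & q %| #|Q|.
  by have [Q1 | [q]] := trivgVpdiv Q; [rewrite Q1 eqxx in ntQ | exists q].
have abQ: abelian Q.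
  have [P sylP nPR] := sol_coprime_Sylow_exists q (pgroup_sol pRU) nQR coQR.
  have ntP: P :!=: 1.
    apply: contraTneq q_dv => P1; have := card_Hall sylP; rewrite P1 cards1 => /esym.
    by move/eqP; rewrite p_part_eq1 mem_primes q_pr cardG_gt0.
  have defP: P = Q by apply/val_inj/minQ'; rewrite ?ntP ?(pHall_sub sylP).
  have solQ: solvable Q by rewrite -defP (pgroup_sol (pHall_pgroup sylP)).
  by have [_ _ /and3P[]] := minnormal_solvable minQ (subxx _) solQ.
have [H defQ sUH sHG] := inv_quotientS nsUG (subset_trans sQK (pcore_sub _ _)).
have nsUH := normalS sUH sHG nsUG.
have nHR: R \subset 'N(H).
  rewrite -(quotientSGK nUR) ?(subset_trans sUH (normG H)) //.
  by rewrite quotient_normG // -defQ.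
have defG: H <*> R = G.
  apply/eqP; apply: contraT => neHRG.
  have ltHRG: (H <*> R)%G \proper G by rewrite properEneq neHRG join_subG sHG.
  have pnHR := mincex_sub sylR (joing_subr H R) ltHRG.
  have [x Hx ox]: {x | x \in H & #[x] = q}.
    by apply: Cauchy => //; apply: dvdn_trans q_dv _; rewrite defQ dvdn_quotient.
  have q'p: q != p by have := pgroupP p'Q q q_pr q_dv.
  have sxU: <[x]> \subset U.
    apply: subset_trans mincex_cent; rewrite subsetI cycle_subG (subsetP sHG) //=.
    apply: (p_nilpotent_cent pnHR).
    - exact: pcore_pgroup.
    - by apply: normalS (subset_trans sUH (joing_subl _ _)) _ nsUG; rewrite join_subG sHG.
    - by rewrite cycle_subG (subsetP (joing_subl _ _)).
    by rewrite /pgroup -orderE ox pnatE.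
  have := pgroupS sxU (pcore_pgroup p G); rewrite /pgroup -orderE ox pnatE //.
  by rewrite inE /= (negPf q'p).
exists H; split; rewrite -?defQ //.
  by rewrite /normal sHG -defG join_subG normG.
by rewrite -norm_joinEr.
Qed.

Let V := 'Z(U)%G.

(** By minimality of [H / U], either [C :&: H] lies in [U] or [H] centralizes [V]. The latter would
    make ['Z(R)], a subgroup of [V], normal in [H * R = G]. In the former case [C] is a p-group,
    since all p'-elements of [G] lie in [H]. *)
Lemma mincex_cent_center : 'C_G(V) = U.
Proof.
have nsUG: U <| G := pcore_normal p G; have [sUG nUG] := andP nsUG.
have pU: p.-group U := pcore_pgroup p G.
have [R sylR] := Sylow_exists p G.
have [H [sUH nsHG defG p'HU [abHU minHU]]] := mincex_structure sylR.
have [sRG pR _] := and3P sylR.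
have sUR: U \subset R := pcore_sub_Hall sylR.
have [sHG nHG] := andP nsHG.
have nsVG: V <| G by apply: gFnormal_trans.
set C := 'C_G(V); have nsCG: C <| G.
  by have := subcent_normal G V; rewrite (setIidPl (normal_norm nsVG)).
have sUC: U \subset C by rewrite subsetI sUG centsC subsetIr.
have [/andP[ntHU nHUR] minHU'] := mingroupP minHU.
have sCHU: C :&: H \subset U.
  have [HU1 | ntCHU] := eqVneq ((C :&: H) / U) 1.
    by rewrite -quotient_sub1 ?HU1 // (subset_trans _ nUG) // subIset ?sHG ?orbT.
  have eqCH: (C :&: H) / U = H / U.
    apply: (minHU' [group of (C :&: H) / U]); last by rewrite quotientS ?subsetIr.
    by rewrite ntCHU quotient_norms // normsI ?(subset_trans sRG) ?normal_norm.
  have sHC: H \subset C.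
    have: H / U \subset C / U by rewrite -eqCH quotientS ?subsetIl.
    by rewrite quotientSGK // (subset_trans sHG).
  case/negP: (mincex_norm_nontriv nZ sylR).
  have sZU: 'Z(R) \subset U.
    apply: subset_trans mincex_cent; rewrite subsetI (subset_trans (center_sub R)) //.
    by rewrite centsC (subset_trans sUR) // centsC subsetIr.
  have sZV: 'Z(R) \subset V.
    by rewrite subsetI sZU centsC (subset_trans sUR) // centsC subsetIr.
  rewrite /normal (subset_trans (center_sub R)) //= -defG mul_subG ?gFnorm //.
  by rewrite cents_norm // (subset_trans sHC) // subIset // (centS sZV) orbT.
have pC: p.-group C.
  apply: p_elts_pgroup => x Cx p'x; have [Gx _] := setIP Cx.
  suff Hx: x \in H.
    have Ux: x \in U by rewrite (subsetP sCHU) // inE Cx.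
    rewrite -(constt_p_elt p'x); apply/constt1P; rewrite p_eltNK; exact: mem_p_elt pU Ux.
  have pGH: p.-group (G / H) by rewrite -defG quotientMidl quotient_pgroup.
  have nHx: x \in 'N(H) := subsetP nHG x Gx.
  apply: coset_idr => //; rewrite -(constt_p_elt p'x) morph_constt //.
  by apply/constt1P; rewrite p_eltNK; apply: mem_p_elt pGH (mem_quotient H Gx).
by apply/eqP; rewrite eqEsubset sUC pcore_max.
Qed.

Lemma mincex_false : False.
Proof.
have nsUG: U <| G := pcore_normal p G; have [sUG nUG] := andP nsUG.
have pU: p.-group U := pcore_pgroup p G.
have [R sylR] := Sylow_exists p G.
have [H [sUH nsHG defG p'HU [abHU minHU]]] := mincex_structure sylR.
have [sRG pR _] := and3P sylR.
have sUR: U \subset R := pcore_sub_Hall sylR.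
have [sHG nHG] := andP nsHG.
have nsVG: V <| G by apply: gFnormal_trans.
have [sVG nVG] := andP nsVG.
have pV: p.-group V := pgroupS (center_sub U) pU.
(* Otherwise [R] and [U] have the same Thompson subgroup, which is then normal in [G]. *)
have [A maxA nsAU]: exists2 A : {group gT}, max_abelian R A & ~~ (A \subset U).
  apply/exists_inP; apply: contraR (mincex_norm_nontriv nJ sylR) => /exists_inPn sAU.
  have sJU: Thompson_J R \subset U.
    by apply/Thompson_J_subP=> A maxA; have := sAU A maxA; rewrite negbK.
  by rewrite /= -(Thompson_J_eq sJU sUR); apply: (gFnormal_trans Thompson_J_igFun).
have [sAR abA maxAb] := max_abelianP _ _ maxA.
have sAG := subset_trans sAR sRG.
have ncAV: ~~ (A \subset 'C(V)).
  by apply: contra nsAU => cAV; rewrite -mincex_cent_center subsetI sAG.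
have abV: abelian V := center_abelian U.
have sVR: V \subset R := subset_trans (center_sub U) sUR.
have nsVR: V <| R := normalS sVR sRG nsVG.
(* The product of ['C_A(V)] and [V] is an abelian subgroup of [R], of order at most [#|A|]; their
   intersection lies in ['C_V(A)]. *)
have offA: #|'C_A(V)| * #|V| <= #|A| * #|'C_V(A)|.
  have cCV: V \subset 'C('C_A(V)) by rewrite centsC subsetIr.
  rewrite mul_cardG -(cent_joinEr cCV) leq_mul ?maxAb //.
  - by rewrite join_subG subIset ?sAR.
  - by rewrite abelianY (abelianS (subsetIl _ _) abA) abV.
  rewrite subset_leq_card // subsetI subsetIr /= -setIA subIset //.
  by rewrite -abelianE abA.
have [x [Ax ncx quad]] := quadratic_offender (pgroup_nil pR) nsVR abV sAR abA ncAV offA.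
have Rx := subsetP sAR x Ax; have Gx := subsetP sRG x Rx.
have comm_yx y : y \in H -> [~ y, x] \in U.
  move=> Hy; have Gy := subsetP sHG y Hy.
  (* As [H / U] is abelian and [U] centralizes [V], [y] commutes with its conjugates by [x] and
     [x^-1] up to ['C(V)]. *)
  have HUc z : z \in H -> [~ y, z] \in 'C(V).
    move=> Hz; suff: [~ y, z] \in U by rewrite -mincex_cent_center => /setIP[].
    have : [~: H, H] \subset U by rewrite -quotient_cents2 ?(subset_trans sHG).
    by move/subsetP->; rewrite ?mem_commg.
  rewrite -mincex_cent_center inE groupR //=.
  apply: (@quadratic_comm _ _ abV x y #|H / U|); rewrite ?cardG_gt0 ?(subsetP nVG) //.
  - exact: odd_pgroup_odd odd_p pV.
  - exact: pnat_coprime pV p'HU.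
  - have Uym: y ^+ #|H / U| \in U.
      have nUy: y \in 'N(U) := subsetP nUG y Gy.
      by apply: coset_idr; rewrite ?groupX // morphX // expg_cardG ?mem_quotient.
    by have: y ^+ #|H / U| \in 'C_G(V) by [rewrite mincex_cent_center]; case/setIP.
  - by apply: HUc; rewrite memJ_norm ?(subsetP nHG).
  by apply: HUc; rewrite memJ_norm ?groupV ?(subsetP nHG).
(* [E] is a p-group normalized by both factors of [G / U], whose p-core is trivial; yet it contains
   the image of [x]. *)
set E := 'C_(R / U)(H / U).
have nsE: E <| G / U.
  have nUH := subset_trans sHG nUG.
  have defGU: (H / U) * (R / U) = G / U by rewrite -quotientMl ?defG.
  suff nEHR: (H / U) * (R / U) \subset 'N(E).
    by rewrite defGU in nEHR; rewrite /normal subIset ?quotientS.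
  rewrite mul_subG //.
    by rewrite cents_norm // centsC subsetIr.
  rewrite normsI ?normG // norms_cent // quotient_norms //.
  exact: subset_trans sRG nHG.
have E1: E = 1.
  apply/trivgP; rewrite -(trivg_pcore_quotient p G) pcore_max //.
  by apply: pgroupS (subsetIl _ _) _; apply: quotient_pgroup.
have Ex: coset U x \in E.
  rewrite inE mem_quotient //=; apply/centP=> _ /morphimP[y nUy Hy ->].
  have nUx: x \in 'N(U) := subsetP nUG x Gx.
  apply/commute_sym/commgP; rewrite -morphR //=; apply/eqP.
  exact: coset_id (comm_yx y Hy).
case/negP: ncx; move: Ex; rewrite E1 => /set1P xU1.
have: x \in U by apply: coset_idr => //; apply: (subsetP nUG).
by rewrite -mincex_cent_center => /setIP[].
Qed.
End MinimalCounterexample.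

Theorem Thompson_p_nilpotent (p : nat) (gT : finGroupType) (G : {group gT}) :
    odd p ->
    norm_p_nilpotent p Thompson_J_igFun G -> norm_p_nilpotent p [igFun of @center] G ->
  p_nilpotent p G.
Proof.
move=> odd_p; have [n] := ubnP #|G|; elim: n gT G => // n IHn gT G /ltnSE-leGn nJ nZ.
apply: contraT => npG; case: (mincex_false odd_p _ nJ nZ npG) => rT H ltHG.
exact/IHn/(leq_trans ltHG).
Qed.
(** * Fixed-point-free automorphisms of prime order *)

Section FixedPointFree.
Variables (gT : finGroupType) (G : {group gT}) (a : gT).
Hypotheses (pr_a : prime #[a]) (nGa : a \in 'N(G)) (cGa : 'C_G[a] = 1).

(** The number of fixed points of [<[a]>] on [G] is 1, and it is congruent to [#|G|] modulo
    [#[a]]. *)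
Lemma prime_fpf_coprime : coprime #|G| #[a].
Proof.
rewrite coprime_sym prime_coprime //; apply/negP=> a_dvd.
have pA: #[a].-group <[a]> by rewrite /pgroup -orderE pnat_id.
have actA: [acts <[a]>, on G | 'J] by rewrite astabsJ cycle_subG.
have := pgroup_fix_mod pA actA.
rewrite afixJ cent_cycle cGa cards1 (eqP a_dvd) modn_small ?prime_gt1 //.
Qed.

Lemma prime_fpf_sub (H : {group gT}) : H \subset G -> 'C_H[a] = 1.
Proof. by move=> sHG; apply/trivgP; rewrite -cGa setSI. Qed.

Lemma prime_fpf_order_quo (V : {group gT}) : V \subset G -> a \in 'N(V) -> prime #[coset V a].
Proof.
move=> sVG nVa; suff ->: #[coset V a] = #[a] by [].
apply: nt_prime_order => //; first by rewrite -morphX // expg_order morph1.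
apply/eqP=> a1; have Va: a \in V by apply: coset_idr.
have: a \in 'C_G[a] by rewrite inE (subsetP sVG) ?cent1id.
by rewrite cGa => /set1P a_1; move: pr_a; rewrite a_1 order1.
Qed.

Lemma prime_fpf_quo (V : {group gT}) :
  V <| G -> a \in 'N(V) -> solvable V -> 'C_(G / V)[coset V a] = 1.
Proof.
move=> nsVG nVa solV; have [sVG _] := andP nsVG.
rewrite -cent_cycle -quotient_cycle // -coprime_norm_quotient_cent ?cycle_subG //.
  by rewrite cent_cycle cGa quotient1.
exact: coprimeSg sVG prime_fpf_coprime.
Qed.

Lemma prime_fpf_Sylow q : exists2 Q : {group gT}, q.-Sylow(G) Q & a \in 'N(Q).
Proof.
have [|||Q sylQ nQa] := @sol_coprime_Sylow_exists _ q <[a]>%G G.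
- exact/abelian_sol/cycle_abelian.
- by rewrite cycle_subG.
- exact: prime_fpf_coprime.
by exists Q; rewrite // -cycle_subG.
Qed.

(** Every Sylow subgroup is normal: take [Q] invariant under [a]; [V <*> Q] is normal since [G / V]
    is nilpotent. Either [Q] contains [V], or [Q] centralizes [V] by [cent_prime_fpf] and is the
    q-core of [V <*> Q]. *)
Lemma prime_fpf_nilpotent_ext (s : nat) (V : {group gT}) :
    V <| G -> abelian V -> s.-group V -> a \in 'N(V) -> nilpotent (G / V) ->
  nilpotent G.
Proof.
move=> nsVG abV sV nVa nilGV; have [sVG nVG] := andP nsVG.
suff sylF: G \subset 'F(G) by rewrite (nilpotentS sylF) ?Fitting_nil.
rewrite -{1}(Sylow_gen G) gen_subG; apply/bigcupsP=> P /SylowP[q q_pr sylP].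
suff [Q sylQ nsQG]: exists2 Q : {group gT}, q.-Sylow(G) Q & Q <| G.
  have [x Gx ->] := Sylow_trans sylQ sylP.
  rewrite (normP (subsetP (normal_norm nsQG) x Gx)).
  by rewrite Fitting_max ?(pgroup_nil (pHall_pgroup sylQ)).
have [Q sylQ nQa] := prime_fpf_Sylow q; exists Q => //.
have [sQG qQ _] := and3P sylQ; have nVQ := subset_trans sQG nVG.
have nsVQ: V <*> Q <| G.
  have nsQV: Q / V <| G / V.
    by rewrite (nilpotent_Hall_pcore nilGV (quotient_pHall nVQ sylQ)) pcore_normal.
  rewrite /normal join_subG sVG sQG -(quotientSGK nVG); last first.
    by apply: subset_trans (joing_subl V Q) (normG _).
  by rewrite quotient_normG ?normalYl // quotientYidl // normal_norm.
have [eq_qs | ne_qs] := eqVneq q s.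
  have sVQ: V \subset Q.
    by apply: subset_trans (pcore_sub_Hall sylQ); rewrite pcore_max // eq_qs.
  by move: nsVQ; rewrite (joing_idPr sVQ).
have cVQ: Q \subset 'C(V).
  apply: (cent_prime_fpf abV pr_a nVa nQa nVQ); rewrite ?prime_fpf_sub //.
  apply: (pnat_coprime sV); apply: sub_in_pnat qQ => t _ /eqnP->.
  by rewrite !inE.
have <-: 'O_q(V <*> Q) = Q.
  apply: normal_Hall_pcore.
    exact: pHall_subl (joing_subr V Q) (normal_sub nsVQ) sylQ.
  by rewrite /normal joing_subr join_subG normG andbT cents_norm // centsC.
exact: gFnormal_trans.
Qed.
End FixedPointFree.

(** Induction on the order: a nontrivial a-invariant normal s-subgroup suffices, by passing to the
    quotient by its center. The p-complement theorem for an odd prime [r] provides one, the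
    normalizers involved being proper and hence nilpotent. *)
Theorem prime_fpf_nilpotent (gT : finGroupType) (G : {group gT}) a :
  prime #[a] -> a \in 'N(G) -> 'C_G[a] = 1 -> nilpotent G.
Proof.
have [n] := ubnP #|G|; elim: n gT G a => // n IHn gT G a /ltnSE-leGn pr_a nGa cGa.
have nGA: <[a]> \subset 'N(G) by rewrite cycle_subG.
have by_quo (s : nat) (V : {group gT}) :
    V <| G -> <[a]> \subset 'N(V) -> s.-group V -> V :!=: 1 -> nilpotent G.
  move=> nsVG nVA sV ntV; pose Z := 'Z(V)%G.
  have nsZG: Z <| G by apply: gFnormal_trans.
  have nZa: a \in 'N(Z) by rewrite -cycle_subG gFnorm_trans.
  have ntZ: Z :!=: 1 by apply: contraNneq ntV => /(trivg_center_pgroup sV) ->.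
  have abZ: abelian Z := center_abelian V.
  apply: (prime_fpf_nilpotent_ext pr_a nGa cGa nsZG abZ) => //.
    exact: pgroupS (center_sub V) sV.
  apply: (IHn _ _ (coset Z a)).
  - by apply: leq_trans leGn; rewrite ltn_quotient ?normal_sub.
  - exact: prime_fpf_order_quo pr_a cGa _ (normal_sub nsZG) nZa.
  - by rewrite (subsetP (quotient_norms _ nGA)) // mem_quotient ?cycle_id.
  exact: prime_fpf_quo pr_a nGa cGa _ nsZG nZa (abelian_sol abZ).
have proper_nil (H : {group gT}) : H \proper G -> <[a]> \subset 'N(H) -> nilpotent H.
  move=> ltHG nHA; apply: (IHn _ _ a) => //; last exact: prime_fpf_sub (proper_sub ltHG).
    exact: leq_trans (proper_card ltHG) leGn.
  by rewrite -cycle_subG.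
have [/hasP[r] | /hasPn evenG] := boolP (has odd (primes #|G|)); last first.
  apply: (@pgroup_nil _ 2); apply/pgroupP=> q q_pr q_dv.
  have: ~~ odd q by rewrite evenG // mem_primes q_pr cardG_gt0.
  by case: (even_prime q_pr) => [-> | ->].
rewrite mem_primes => /and3P[r_pr _ r_dv] odd_r.
have [R sylR nRa] := prime_fpf_Sylow pr_a nGa cGa r.
have [sRG rR _] := and3P sylR.
have ntR: R :!=: 1.
  apply: contraTneq r_dv => R1; have := card_Hall sylR; rewrite R1 cards1 => /esym.
  by move/eqP; rewrite p_part_eq1 mem_primes r_pr cardG_gt0.
have nRA: <[a]> \subset 'N(R) by rewrite cycle_subG.
have by_functor (F : GFunctor.iso_map) :
  F gT R != 1 -> ~~ nilpotent G -> norm_p_nilpotent r F G.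
- move=> ntF not_nilG; apply: (norm_p_nilpotent_conj sylR).
  have sFG: F gT R \subset G := subset_trans (gFsub F R) sRG.
  have nFA: <[a]> \subset 'N(F gT R) by apply: gFnorm_trans.
  apply: nilpotent_pcore_Hall; apply: proper_nil; last by rewrite normsI ?norms_norm.
  rewrite properE subsetIl subsetI subxx /=; apply: contra not_nilG => nFG.
  have nsFG: gFgroup F R <| G by rewrite /normal sFG.
  exact: by_quo nsFG nFA (pgroupS (gFsub F R) rR) ntF.
apply: contraT => not_nilG.
have pnG: p_nilpotent r G.
  apply: (Thompson_p_nilpotent odd_r); apply: by_functor => //.
    exact: Thompson_J_pgroup_neq1 rR ntR.
  by apply: contraNneq ntR => /(trivg_center_pgroup rR) ->.
(* If [K] is trivial, [G] is an r-group; otherwise [K] is proper, hence nilpotent, and one of its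
   Sylow subgroups is the normal subgroup sought. *)
set K := 'O_r^'(G)%G; have nsKG: K <| G := pcore_normal _ _.
have [K1 | [s s_pr s_dv]] := trivgVpdiv K.
  have /and3P[_ _] := pnG; rewrite -['O_r^'(G)]/(gval K) K1 indexg1 pnatNK => rG.
  by rewrite (pgroup_nil (rG : r.-group G)) in not_nilG.
have nilK: nilpotent K.
  apply: proper_nil; last exact: gFnorm_trans.
  rewrite properEneq (normal_sub nsKG) andbT; apply: contraNneq ntR => defK.
  have r'R: r^'.-group R by rewrite (pgroupS sRG) // -defK pcore_pgroup.
  by rewrite -(setIid R) (coprime_TIg (pnat_coprime rR r'R)).
have nsSG: 'O_s(K) <| G by apply: gFnormal_trans.
case/negP: not_nilG; apply: (by_quo s _ nsSG).
- by do 2!apply: gFnorm_trans.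
- exact: pcore_pgroup.
apply: contraTneq s_dv => S1; have := card_Hall (nilpotent_pcore_Hall s nilK).
by rewrite S1 cards1 => /esym/eqP; rewrite p_part_eq1 mem_primes s_pr cardG_gt0.
Qed.

(** * Quasi-semiregular elements and regular socles *)

Lemma socle_norm (gT : finGroupType) (G : {group gT}) : G \subset 'N(socle G).
Proof.
apply/norms_gen/norms_bigcup/bigcapsP=> N /andP[/mingroupP[/andP[_ nNG] _] _].
exact: nNG.
Qed.

Theorem theorem5p6 (Omega : finType) (G : {group {perm Omega}}) :
  [primitive G, on [set: Omega] | 'P] -> TW_type G ->
  ~ (exists2 g, g \in G & quasi_semiregular g).
Proof.
move=> _ [[_ semiregN] nabN [T [k [k_ge2 simT nabT [Ti [defN isoT]]]]]].
case=> g Gg [w fixg semireg_g].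
pose N := [group of socle G].
(* If [g = 1], uniqueness of the fixed point leaves a single point, and the socle would be
   abelian. *)
have ntg: g != 1.
  apply: contraNneq nabN => g1; apply/centsP=> x Nx y Ny.
  have Omega1 z : z = w.
    apply/set1P; rewrite -fixg g1; apply/afixP=> h.
    by rewrite cycle1 => /set1P->; apply: act1.
  by congr (_ * _); apply/permP=> z; rewrite (Omega1 (x z)) (Omega1 (y z)).
have g_gt1: 1 < #[g] by rewrite order_gt1.
have [h gh oh] := Cauchy (pdiv_prime g_gt1) (pdiv_dvd #[g]).
have pr_h: prime #[h] by rewrite oh pdiv_prime.
have hw: h w = w.
  have : w \in 'Fix_('P)(<[g]>) by rewrite fixg set11.
  by move/afixP/(_ h gh).
(* An [n] commuting with [h] maps the fixed point [w] to a fixed point of [h], which must be [w]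
   since [<[g]>] is semiregular elsewhere; regularity of [N] then forces [n = 1]. *)
have cNh: 'C_N[h] = 1.
  apply/trivgP/subsetP=> n /setIP[Nn /cent1P cnh].
  suff nw: n w = w.
    by rewrite -(semiregN w (in_setT w)) inE Nn; apply/astab1P.
  apply/eqP; apply: contraT => nw; have := semireg_g (n w); rewrite !inE => /(_ nw) C1.
  have: h \in 'C_(<[g]>)[n w | 'P].
    by rewrite inE gh; apply/astab1P; rewrite /= apermE -permM cnh permM hw.
  by rewrite C1 => /set1P h1; move: pr_h; rewrite h1 order1.
have nNh: h \in 'N(N) by rewrite (subsetP (socle_norm G)) // (subsetP _ h gh) ?cycle_subG.
have nilN: nilpotent N := prime_fpf_nilpotent pr_h nNh cNh.
have nilT: nilpotent T.
  have k_gt0: 0 < k := ltnW k_ge2.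
  have i0 := Ordinal k_gt0; rewrite -(isog_nil (isoT i0)); apply: nilpotentS nilN.
  have defN': \big[dprod/1]_(i < k) Ti i = N := defN.
  by rewrite -(bigdprodWY defN') sub_gen // (bigcup_sup i0).
case/negP: nabT; apply/cyclic_abelian/prime_cyclic.
exact: simple_sol_prime (nilpotent_sol nilT) simT.
Qed.
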